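(* Let $\lambda^*>0$ satisfy $\sum_{n=1}^{\infty}\prod_{i=1}^{n}\frac{1}{1+i\lambda^*}=1$. The limiting empirical degree distribution of a sequence of random graphs following the inverse de-preferential attachment model with $m=1$, that is, the probability distribution $(\tilde p_k)_{k\ge1}$ with $$\tilde p_k=\frac{k\lambda^*}{k\lambda^*+1}\prod_{i=1}^{k-1}\frac{1}{i\lambda^*+1},$$ has mean $2$, has mode $1$ (i.e. $\tilde p_1\ge\tilde p_k$ for all $k\ge1$), and its tail decays at a rate faster than exponential, i.e. for every $c>0$, $e^{cn}\sum_{k=n}^\infty\tilde p_k\to0$ as $n\to\infty$.
   Context: Inverse de-preferential attachment model with $m=1$: the graph $G_n$ has vertices $v_1,\dots,v_n$, and $d_i(n)$ denotes the degree of $v_i$ in $G_n$ (all incident edges and half-edges counted). The process starts from $G_2$, consisting of two vertices $v_1,v_2$ joined by an edge together with one extra ''free'' half-edge attached to one of the two vertices, which counts toward that vertex's degree. Given $G_n$, a new vertex $v_{n+1}$ is joined by a single edge to $v_i$, $1\le i\le n$, with conditional probability $C_n/d_i(n)$, where $C_n^{-1}=\sum_{j=1}^n 1/d_j(n)$. The limiting empirical degree distribution is $\tilde p_k=\lim_{n\to\infty}\frac1n\#\{i\le n:d_i(n)=k\}$ (almost sure limit), which is given by the formula in the claim. Empty products equal $1$. *)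

(* Defs.v *)
From mathcomp Require Import all_boot all_order all_algebra.
From mathcomp Require Import all_classical all_reals all_analysis.
Import Order.TTheory GRing.Theory Num.Theory.
Import numFieldNormedType.Exports.

Set Implicit Arguments.
Unset Strict Implicit.
Unset Printing Implicit Defensive.

Local Open Scope classical_set_scope.
Local Open Scope ring_scope.

(* The vertices v_1, ..., v_N (N = order) are represented by 1, ..., N. *)
Record hgraph := HGraph {
  order : nat;
  edges : seq (nat * nat);
  half_edges : seq nat }.

Definition deg (g : hgraph) (i : nat) : nat :=
  (count (fun e => e.1 == i) (edges g) + count (fun e => e.2 == i) (edges g)
   + count_mem i (half_edges g))%N.

Definition seed (i : nat) : hgraph := HGraph 2 [:: (1, 2)] [:: i].

Definition attach (g : hgraph) (i : nat) : hgraph :=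
  HGraph (order g).+1 (((order g).+1, i) :: edges g) (half_edges g).

Definition attach_const (R : realType) (g : hgraph) : R :=
  (\sum_(1 <= j < (order g).+1) (deg g j)%:R^-1)^-1.

(* [G n] is the random graph G_n; only the indices n >= 2 matter.  The
   position of the half-edge of G_2 may be deterministic or random.  In the
   last clause the conditional probability given {G_n = g} is written in
   product form, so that null events need no special treatment. *)
Record inverse_depa d (T : measurableType d) (R : realType)
    (P : probability T R) (G : nat -> T -> hgraph) : Prop := InverseDepa {
  depa_measurable : forall n g, (2 <= n)%N -> measurable [set w | G n w = g];
  depa_init : forall w, G 2 w = seed 1 \/ G 2 w = seed 2;
  depa_step : forall n w, (2 <= n)%N ->
    exists2 i, (1 <= i <= n)%N & G n.+1 w = attach (G n w) i;
  depa_prob : forall n g i, (2 <= n)%N -> (1 <= i <= n)%N ->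
    P [set w | G n w = g /\ G n.+1 w = attach g i] =
    ((attach_const R g / (deg g i)%:R)%:E * P [set w | G n w = g])%E }.

Definition degree_freq (R : realType) (g : hgraph) (k : nat) : R :=
  (count (fun i => deg g i == k) (iota 1 (order g)))%:R / (order g)%:R.

Definition limiting_degree_distribution d (T : measurableType d)
    (R : realType) (P : probability T R) (G : nat -> T -> hgraph)
    (p : nat -> R) : Prop :=
  {ae P, forall w, forall k, (1 <= k)%N ->
    (fun n => degree_freq R (G n w) k) @ \oo --> p k}.

Definition ptilde (R : realType) (lambda : R) (k : nat) : R :=
  (k%:R * lambda) / (k%:R * lambda + 1)
  * \prod_(1 <= i < k) (1 / (i%:R * lambda + 1)).

(* Main.v *)
Require Import Defs.
From HB Require Import structures.
From mathcomp Require Import all_boot all_order all_algebra.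
From mathcomp Require Import all_classical all_reals all_analysis.
From mathcomp Require Import zify ring lra.
Import Order.TTheory GRing.Theory Num.Theory.
Import numFieldNormedType.Exports.

Local Open Scope classical_set_scope.
Local Open Scope ring_scope.

(** Let [Y_k(n)] be the number of vertices of degree at least [k] in [G_n] and
    [S(n)] the sum of the inverse degrees.  Given [G_n], a vertex of degree [k]
    is picked with probability [q_k(n) = (Y_k(n) - Y_{k+1}(n)) / (k S(n))], and
    [Y_{k+1}] then grows by one.  The martingale [Y_{k+1} - \sum q_k] has
    bounded increments, hence is almost surely [o(n)].  On that event, an
    asymptotic lower bound [a] for [S(n)/n] gives the upper bound
    [surv a k = \prod_(1 <= i < k) 1 / (1 + i a)] for [Y_k(n)/n], and an upper
    bound [b] gives the lower bound [surv b k].  Since [S(n)] decreases in the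
    [Y_k(n)], these in turn improve [a] to [a rho(a)] and [b] to [b rho(b)],
    where [rho(s) = \sum_(n >= 1) surv s (n + 1)] decreases in [s] and
    [rho(lambda) = 1].  Hence both bounds can be pushed to [lambda], and the
    proportion of vertices of degree [k] tends to
    [surv lambda k - surv lambda (k + 1) = ptilde lambda k].  The properties of
    [ptilde] follow from this telescoping form, the mode also from
    [lambda >= 1/2]. *)

(** * The limiting distribution *)

Definition surv {R : realType} (s : R) (k : nat) : R :=
  \prod_(1 <= i < k) (1 / (i%:R * s + 1)).

(** Truncating at [K] keeps finitely many degree classes; the terms run from [surv s 2] to
    [surv s K.+1]. *)
Definition rho {R : realType} (s : R) (K : nat) : R :=
  \sum_(1 <= n < K.+1) surv s n.+1.

Lemma surv1 {R : realType} (s : R) : surv s 1 = 1.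
Proof. by rewrite /surv big_geq. Qed.

Lemma survS {R : realType} (s : R) (k : nat) :
  surv s k.+1 = surv s k / (k%:R * s + 1).
Proof.
case: k => [|k]; first by rewrite /surv !big_geq// mul0r add0r divr1.
by rewrite /surv big_nat_recr//= mul1r.
Qed.

Lemma surv_gt0 {R : realType} (s : R) (k : nat) : 0 <= s -> 0 < surv s k.
Proof.
move=> s0; elim: k => [|k IH]; first by rewrite /surv big_geq.
by rewrite survS divr_gt0// ltr_wpDl// mulr_ge0.
Qed.

Lemma surv_nonincreasing {R : realType} (s : R) (k : nat) :
  0 <= s -> surv s k.+1 <= surv s k.
Proof.
move=> s0; have k0 : 0 <= k%:R * s by rewrite mulr_ge0.
rewrite survS ler_pdivrMr ?ltr_wpDl//; apply: ler_peMr; first exact/ltW/surv_gt0.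
by rewrite lerDr.
Qed.

Lemma surv_le1 {R : realType} (s : R) (k : nat) : 0 <= s -> surv s k <= 1.
Proof.
move=> s0; elim: k => [|k IH]; first by rewrite /surv big_geq.
exact: le_trans (surv_nonincreasing _ _ s0) IH.
Qed.

Lemma surv_anti {R : realType} (a b : R) (k : nat) :
  0 <= a -> a <= b -> surv b k <= surv a k.
Proof.
move=> a0 ab; have b0 := le_trans a0 ab.
elim: k => [|k IH]; first by rewrite /surv !big_geq.
have ak : 0 <= k%:R * a by rewrite mulr_ge0.
have bk : 0 <= k%:R * b by rewrite mulr_ge0.
rewrite !survS; apply: ler_pM => //; first exact/ltW/surv_gt0.
  by rewrite invr_ge0 addr_ge0.
by rewrite lef_pV2 ?posrE ?ltr_wpDl// lerD2r ler_wpM2l.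
Qed.

Lemma surv_continuous {R : realType} (s : R) (k : nat) :
  0 < s -> surv t k @[t --> s] --> surv s k.
Proof.
move=> s0; elim: k => [|k IH].
  rewrite /surv big_geq//; under eq_fun do rewrite big_geq//.
  exact: cvg_cst.
rewrite survS; under eq_fun do rewrite survS.
apply: cvgM => //; apply: cvgV; first by rewrite gt_eqF// ltr_wpDl// mulr_ge0// ltW.
by apply: cvgD; [apply: cvgM; [exact: cvg_cst|exact: cvg_id]|exact: cvg_cst].
Qed.

Lemma rho_anti {R : realType} (a b : R) (K : nat) :
  0 <= a -> a <= b -> rho b K <= rho a K.
Proof. by move=> a0 ab; apply: ler_sum_nat => n _; exact: surv_anti. Qed.

(* All terms are monotone in [s]; the first one gives a gap uniform in [K]. *)
Lemma rho_gap {R : realType} (a b : R) (K : nat) : 0 <= a -> a <= b ->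
  rho b K.+1 + (1 / (a + 1) - 1 / (b + 1)) <= rho a K.+1.
Proof.
move=> a0 ab; rewrite /rho !(big_nat_recl K.+1 1)//= !(survS _ 1) !surv1 !mul1r.
suff : \sum_(1 <= i < K.+1) surv b i.+2 <= \sum_(1 <= i < K.+1) surv a i.+2 by lra.
by apply: ler_sum_nat => n _; exact: surv_anti.
Qed.

(** Balance equation of the limit: if [S] grows like [s n], vertices of degree [k] are picked at
    rate [(surv s k - surv s k.+1) / (k s)], which must equal the growth rate [surv s k.+1] of the
    next class. *)
Lemma surv_sub {R : realType} (s : R) (k : nat) : 0 <= s ->
  surv s k - surv s k.+1 = k%:R * s * surv s k.+1.
Proof.
move=> s0; have k0 : 0 <= k%:R * s by rewrite mulr_ge0.
by rewrite survS; field; rewrite gt_eqF// ltr_wpDl.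
Qed.

Lemma ptildeE {R : realType} (s : R) (k : nat) : 0 <= s ->
  ptilde s k = surv s k - surv s k.+1.
Proof.
move=> s0; have k0 : 0 <= k%:R * s by rewrite mulr_ge0.
rewrite surv_sub// /ptilde -/(surv s k) survS; field.
by rewrite gt_eqF// ltr_wpDl.
Qed.

Lemma eseries_cvg {R : realType} (a : nat -> R) (m : nat) (l : R) :
  (fun n => \sum_(m <= i < n) a i) @ \oo --> l ->
  (\sum_(m <= i <oo) (a i)%:E = l%:E)%E.
Proof.
move=> al; apply/cvg_lim => //.
under eq_fun do rewrite sumEFin.
by apply: cvg_EFin; [exact: nearW|exact: al].
Qed.

(** * Mean, mode and tail of the limiting distribution *)

Section ptilde.
Context {R : realType} {lambda : R}.
Hypothesis lambda_gt0 : 0 < lambda.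
Hypothesis lambdaE : (\sum_(1 <= n <oo)
  (\prod_(1 <= i < n.+1) (1 / (1 + i%:R * lambda)))%:E = 1 :> \bar R)%E.

Let lambda_ge0 : 0 <= lambda. Proof. exact: ltW. Qed.
Let surv_ge0 k : 0 <= surv lambda k. Proof. exact/ltW/surv_gt0. Qed.

Lemma rho_cvg : rho lambda @ \oo --> (1 : R).
Proof.
pose f n := (\sum_(1 <= i < n) (surv lambda i.+1)%:E)%E.
have : f @ \oo --> (1%:E : \bar R).
  rewrite -[X in _ --> X]/(1 : \bar R)%E -lambdaE.
  rewrite (_ : (\sum_(1 <= n <oo) _)%E = limn f).
    by apply: is_cvg_nneseries => n _ _; rewrite lee_fin.
  by apply: eq_eseriesr => n _; congr EFin; apply: eq_bigr => i _; rewrite addrC.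
move/fine_cvgP => [_]; rewrite -(cvg_shiftS _) /=; apply: cvg_trans.
by apply: near_eq_cvg; apply: nearW => n; rewrite /= /f sumEFin.
Qed.

Lemma rho_le1 (K : nat) : rho lambda K <= 1.
Proof.
rewrite -(cvg_lim _ rho_cvg)//; apply: nondecreasing_cvgn_le; last exact: cvgP rho_cvg.
by apply/nondecreasing_seqP => n; rewrite /rho (big_nat_recr n.+1)//= lerDl.
Qed.

Lemma surv_cvg0 : surv lambda @ \oo --> (0 : R).
Proof.
have h : (fun n => rho lambda n.+1 - rho lambda n) @ \oo --> (0 : R).
  rewrite -(subrr 1); apply: cvgB; last exact: rho_cvg.
  by rewrite (cvg_shiftS (rho lambda)); exact: rho_cvg.
rewrite -(cvg_shiftn 2); apply: cvg_trans h; apply: near_eq_cvg; apply: nearW => n /=.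
by rewrite /rho (big_nat_recr n.+1)//= addrAC subrr add0r addn2.
Qed.

Lemma ptilde_ge0 (k : nat) : 0 <= ptilde lambda k.
Proof. by rewrite ptildeE// subr_ge0 surv_nonincreasing. Qed.

(** The series telescopes, and [surv lambda] tends to 0 as the term of a convergent series. *)
Lemma ptilde_tail (n : nat) :
  (\sum_(n <= k <oo) (ptilde lambda k)%:E = (surv lambda n)%:E)%E.
Proof.
apply: eseries_cvg; rewrite -(cvg_shiftn n) -[surv lambda n]subr0.
under eq_fun.
  move=> m; under eq_bigr do rewrite ptildeE// -opprB.
  rewrite sumrN telescope_sumr ?leq_addl// opprB; over.
by apply: cvgB; [exact: cvg_cst|rewrite (cvg_shiftn n (surv lambda)); exact: surv_cvg0].
Qed.

(** Summation by parts; the boundary terms vanish in the limit, leaving [1 + 1]. *)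
Lemma sum_k_ptilde (K : nat) : \sum_(1 <= k < K.+1) k%:R * ptilde lambda k =
  1 + rho lambda K - surv lambda K.+1 - K%:R * surv lambda K.+1.
Proof.
elim: K => [|K IH].
  by rewrite /rho !big_geq// surv1 mul0r; ring.
rewrite big_nat_recr//= IH ptildeE// /rho (big_nat_recr K.+1)//=.
ring.
Qed.

Lemma ptilde_mean : (\sum_(1 <= k <oo) (k%:R * ptilde lambda k)%:E = 2%:E :> \bar R)%E.
Proof.
apply: eseries_cvg; rewrite -(cvg_shiftS _) /=.
under eq_fun do rewrite sum_k_ptilde.
have sS : surv lambda n.+1 @[n --> \oo] --> (0 : R).
  by rewrite (cvg_shiftS (surv lambda)); exact: surv_cvg0.
rewrite (_ : 2 = 1 + 1 - 0 - 0 :> R); last by ring.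
apply: cvgB; first by apply: cvgB sS; apply: cvgD rho_cvg; exact: cvg_cst.
(* By [surv_sub], [n * surv lambda n.+1] is at most [surv lambda n / lambda]. *)
apply: (@squeeze_cvgr _ _ _ _ (cst 0) (fun n => lambda^-1 * surv lambda n)).
- apply: nearW => n /=; rewrite mulr_ge0//= [leRHS]mulrC ler_pdivlMr//.
  by rewrite mulrAC -surv_sub// gerBl.
- exact: cvg_cst.
- by rewrite -(mulr0 lambda^-1); apply: cvgM surv_cvg0; exact: cvg_cst.
Qed.

(* At [lambda = 1/2] the first two terms of the series are 2/3 and 1/3. *)
Lemma lambda_ge_half : 1 / 2 <= lambda.
Proof.
rewrite leNgt; apply/negP => lt_half.
(* The gap would push [rho lambda 2] strictly above [rho (1/2) 2 = 1]. *)
have := rho_gap lambda (1/2) 1 lambda_ge0 (ltW lt_half).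
have := rho_le1 2.
rewrite {2}/rho 2?big_ltn// big_geq// !(survS _ 2) !(survS _ 1) surv1.
have : 1 / (1 / 2 + 1) < 1 / (lambda + 1).
  rewrite ltr_pM2l// ltf_pV2 ?posrE; [lra|lra|].
  by rewrite ltr_wpDl.
have -> : 1 / (1%:R * (1 / 2) + 1) +
    (1 / (1%:R * (1 / 2) + 1) / (2%:R * (1 / 2) + 1) + 0) = 1 :> R by field.
by lra.
Qed.

(** In fact [ptilde] is nonincreasing from 1 on: comparing [k + 2] with [k + 1] reduces to
    [1 <= (k + 1) (k + 2) lambda], which for [k = 0] is exactly [lambda >= 1/2]. *)
Lemma ptilde_mode (k : nat) : (1 <= k)%N -> ptilde lambda k <= ptilde lambda 1.
Proof.
case: k => // k _; elim: k => [//|k IH]; apply: le_trans IH.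
rewrite !ptildeE// !surv_sub// survS.
set v := surv lambda k.+2.
have k1 : 0 <= k.+2%:R * lambda by rewrite mulr_ge0.
rewrite mulrA ler_pdivrMr ?ltr_wpDl//.
have -> : k.+2%:R * lambda * v = lambda * v * k.+2%:R by ring.
have -> : k.+1%:R * lambda * v * (k.+2%:R * lambda + 1) =
  lambda * v * (k.+1%:R * (k.+2%:R * lambda + 1)) by ring.
rewrite ler_wpM2l ?mulr_ge0 ?surv_ge0//.
have := lambda_ge_half; rewrite -[k.+2%:R]natr1 -[k.+1%:R]natr1.
by have : 0 <= k%:R :> R by []; nra.
Qed.

(** The tail [surv lambda n.+1] is at most [1 / (lambda ^ n n!)], so the product is dominated by a
    multiple of a term of the exponential series at [expR c / lambda]. *)
Lemma ptilde_tail_superexp (c : R) :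
  (fun n => (expR (c * n%:R))%:E *
     \sum_(n <= k <oo) (ptilde lambda k)%:E)%E @ \oo --> 0%E.
Proof.
under eq_fun do rewrite ptilde_tail -EFinM.
apply: cvg_EFin; first exact: nearW.
rewrite -(cvg_shiftS _) /=.
apply: (@squeeze_cvgr _ _ _ _ (cst 0)
  (fun n => expR c * (expR c / lambda) ^+ n / n`!%:R)).
- apply: nearW => n; rewrite mulr_ge0 ?expR_ge0//=.
  elim: n => [|n IH].
    by rewrite surv1 fact0 divr1 !mulr1.
  have -> : expR (c * n.+2%:R) = expR c * expR (c * n.+1%:R).
    by rewrite -expRD -[n.+2%:R]natr1; congr expR; ring.
  rewrite survS factS natrM exprS.
  have n0 : 0 < n.+1%:R * lambda by rewrite mulr_gt0.
  have -> : expR c * (expR c / lambda * (expR c / lambda) ^+ n) / (n.+1%:R * n`!%:R) =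
     expR c * (expR c * (expR c / lambda) ^+ n / n`!%:R) / (n.+1%:R * lambda).
    move: (ltr0Sn R n) (fact_gt0 n); rewrite -(ltr0n R).
    move: n.+1%:R n`!%:R => a b a0 b0.
    by field; rewrite !gt_eqF.
  rewrite [leLHS]mulrA -[_ * _ * surv _ _]mulrA; apply: ler_pM.
  - by rewrite !(expR_ge0, mulr_ge0).
  - by rewrite invr_ge0 addr_ge0// ltW.
  - by rewrite ler_wpM2l ?expR_ge0.
  - by rewrite lef_pV2 ?posrE ?ltr_wpDl ?lerDl// ltW.
- exact: cvg_cst.
- rewrite -(mulr0 (expR c)); under eq_fun do rewrite -mulrA.
  by apply: cvgM; [exact: cvg_cst|exact: cvg_exp_coeff].
Qed.

End ptilde.

(** * Deterministic asymptotics *)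

(* [ev_le f c] is [limsup f n / n <= c]; [ev_ge f c] is [liminf f n / n >= c]. *)
Definition ev_le {R : realType} (f : nat -> R) (c : R) : Prop :=
  forall e, 0 < e -> \forall n \near \oo, f n <= (c + e) * n%:R.

Definition ev_ge {R : realType} (f : nat -> R) (c : R) : Prop :=
  forall e, 0 < e -> \forall n \near \oo, (c - e) * n%:R <= f n.

Lemma ev_leB {R : realType} (f g : nat -> R) (a b c : R) :
  0 <= c <= 1 -> ev_le f a -> ev_ge g b ->
  ev_le (fun n => f n - g n * c) (a - b * c).
Proof.
move=> /andP[c0 c1] fa gb e e0.
have e2 : 0 < e / 2 by rewrite divr_gt0.
near=> n; have h1 : f n <= (a + e / 2) * n%:R by near: n; exact: fa.
have h2 : (b - e / 2) * n%:R <= g n by near: n; exact: gb.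
have := ler_wpM2r c0 h2.
have : e / 2 * n%:R * c <= e / 2 * n%:R by rewrite ler_piMr// mulr_ge0// ltW.
by nra.
Unshelve. all: by end_near. Qed.

Lemma ev_geB {R : realType} (f g : nat -> R) (a b c : R) :
  0 <= c <= 1 -> ev_ge f a -> ev_le g b ->
  ev_ge (fun n => f n - g n * c) (a - b * c).
Proof.
move=> /andP[c0 c1] fa gb e e0.
have e2 : 0 < e / 2 by rewrite divr_gt0.
near=> n; have h1 : (a - e / 2) * n%:R <= f n by near: n; exact: fa.
have h2 : g n <= (b + e / 2) * n%:R by near: n; exact: gb.
have := ler_wpM2r c0 h2.
have : e / 2 * n%:R * c <= e / 2 * n%:R by rewrite ler_piMr// mulr_ge0// ltW.
by nra.
Unshelve. all: by end_near. Qed.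

Lemma ev_le_near {R : realType} (f g : nat -> R) (a b : R) : a <= b ->
  (\forall n \near \oo, g n <= f n) -> ev_le f a -> ev_le g b.
Proof.
move=> ab gf fa e e0; near=> n.
apply: (@le_trans _ _ (f n)); first by near: n.
apply: (@le_trans _ _ ((a + e) * n%:R)); first by near: n; exact: fa.
by rewrite ler_wpM2r// lerD2r.
Unshelve. all: by end_near. Qed.

Lemma ev_ge_near {R : realType} (f g : nat -> R) (a b : R) : b <= a ->
  (\forall n \near \oo, f n <= g n) -> ev_ge f a -> ev_ge g b.
Proof.
move=> ab gf fa e e0; near=> n.
apply: (@le_trans _ _ (f n)); last by near: n.
apply: (@le_trans _ _ ((a - e) * n%:R)); last by near: n; exact: fa.
by rewrite ler_wpM2r// lerD2r.
Unshelve. all: by end_near. Qed.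

Lemma ev_le_cst {R : realType} (a : R) : ev_le (fun n => a * n%:R) a.
Proof. by move=> e e0; near=> n; rewrite ler_wpM2r// lerDl ltW.
Unshelve. all: by end_near. Qed.

Lemma ev_ge_cst {R : realType} (a : R) : ev_ge (fun n => a * n%:R) a.
Proof. by move=> e e0; near=> n; rewrite ler_wpM2r// gerBl ltW.
Unshelve. all: by end_near. Qed.

Lemma ev_ge_le {R : realType} (f : nat -> R) (a b : R) :
  ev_ge f a -> ev_le f b -> a <= b.
Proof.
move=> fa fb; apply/ler_addgt0Pr => e e0.
have e2 : 0 < e / 2 by rewrite divr_gt0.
have [n [n0 h]] : exists n, (0 < n)%N /\ (a - e / 2) * n%:R <= (b + e / 2) * n%:R.
  near \oo => n; exists n; split; first by near: n; exact: nbhs_infty_gt.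
  by apply: (@le_trans _ _ (f n)); near: n; [exact: fa|exact: fb].
by move: h; rewrite ler_pM2r ?ltr0n//; lra.
Unshelve. all: by end_near. Qed.

(** * A drift recursion with negative feedback *)

Section feedback.
Context {R : realType}.
Variables (Y Z S q M : nat -> R) (kappa : R).
Hypothesis kappa_gt0 : 0 < kappa.
Hypothesis YE : forall n, (2 <= n)%N -> Y n.+1 = Y n + q n + (M n.+1 - M n).
Hypothesis qE : forall n, (2 <= n)%N -> q n * (kappa * S n) = Z n - Y n.
Hypothesis q01 : forall n, (2 <= n)%N -> 0 <= q n <= 1.
Hypothesis S_gt0 : forall n, (2 <= n)%N -> 0 < S n.
Hypothesis Y_ge0 : forall n, 0 <= Y n.
Hypotheses (M_le : ev_le M 0) (M_ge : ev_ge M 0).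

(* Whenever [U := Y - M] is above the line [c n], its drift [q] is at most [c]:
   hence it never rises above that line by more than a constant. *)
Lemma feedback_ub (z a : R) : 0 <= z -> 0 < a ->
  ev_le Z z -> ev_ge S a -> ev_le Y (z / (kappa * a + 1)).
Proof.
move=> z0 a0 Zz Sa e e0.
(* The target [z / D] is the fixed point of [c = (z - c) / (kappa a)], the drift along the line
   [c n]. *)
set D := kappa * a + 1.
have D0 : 0 < D by rewrite addr_gt0// mulr_gt0.
pose c := z / D + e / 2.
have cD : c * D = z + e / 2 * D by rewrite /c mulrDl divfK// gt_eqF.
have c0 : 0 < c by rewrite ltr_wpDl ?divr_ge0 ?divr_gt0 ?(ltW D0).
have F0 : 0 < 2 + c * kappa by rewrite addr_gt0// mulr_gt0.
(* Errors [e'] in [Z], [M] and [S] cost [e' (2 + c kappa)] in total, to be covered by the slack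
   [e / 2 * D] in [c * D]. *)
pose e' := Num.min (e / 4) (e / 2 * D / (2 + c * kappa)).
have e'0 : 0 < e' by rewrite lt_min !(divr_gt0, mulr_gt0).
have e'4 : e' <= e / 4 by rewrite ge_min lexx.
have e'F : e' * (2 + c * kappa) <= e / 2 * D by rewrite -ler_pdivlMr// ge_min lexx orbT.
pose U n := Y n - M n.
have [n0 _ H] : \forall n \near \oo, (2 <= n)%N /\ (c * n%:R <= U n -> q n <= c).
  near=> n; have n2 : (2 <= n)%N by near: n; exact: nbhs_infty_ge.
  split=> // Un.
  have hZ : Z n <= (z + e') * n%:R by near: n; exact: Zz.
  have hS : (a - e') * n%:R <= S n by near: n; exact: Sa.
  have hM : (0 - e') * n%:R <= M n by near: n; exact: M_ge.
  rewrite -(ler_pM2r (mulr_gt0 kappa_gt0 (S_gt0 _ n2))) qE//.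
  have h1 := ler_wpM2l (ltW (mulr_gt0 c0 kappa_gt0)) hS.
  have h2 := ler_wpM2r (ler0n R n) e'F.
  have h3 : c * D * n%:R = (z + e / 2 * D) * n%:R by rewrite cD.
  by move: Un h1 h2 h3; rewrite /U /D; lra.
(* A step from below the line overshoots by at most 1, since [q <= 1]; the other term covers the
   start [n0]. *)
pose K := Num.max 1 (U n0 - c * n0%:R).
have K1 : 1 <= K by rewrite le_max lexx.
have UK j : U (j + n0)%N <= c * (j + n0)%:R + K.
  elim: j => [|j IH]; first by rewrite add0n -lerBlDl le_max lexx orbT.
  have [n2 Hq] := H _ (leq_addl j n0).
  have -> : U (j.+1 + n0)%N = U (j + n0)%N + q (j + n0)%N.
    by rewrite /U addSn YE//; ring.
  rewrite addSn -natr1 mulrDr mulr1.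
  have [cU|/ltW cU] := leP (c * (j + n0)%:R) (U (j + n0)%N).
    by have := Hq cU; lra.
  by have /andP[_] := q01 _ n2; lra.
near=> n.
have n0n : (n0 <= n)%N by near: n; exact: nbhs_infty_ge.
have := UK (n - n0)%N; rewrite subnK//.
have hM : M n <= (0 + e') * n%:R by near: n; exact: M_le.
(* The error [e] is spent as [e/2] in [c], [e/4] on [M] and [e/4] on the constant [K]. *)
have hK : K / (e / 4) <= n%:R by near: n; exact: nbhs_infty_ger.
move: hK; rewrite ler_pdivrMr ?divr_gt0// => hK.
have := ler_wpM2r (ler0n R n) e'4.
by rewrite /U /c; lra.
Unshelve. all: by end_near. Qed.

(** Mirror image: below the line [c n] the drift of [U] is at least [c], so [U] cannot fall behind
    by more than a constant. *)
Lemma feedback_lb (z b : R) : 0 <= z -> 0 < b ->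
  ev_ge Z z -> ev_le S b -> ev_ge Y (z / (kappa * b + 1)).
Proof.
move=> z0 b0 Zz Sb e e0.
set D := kappa * b + 1.
have D0 : 0 < D by rewrite addr_gt0// mulr_gt0.
pose c := z / D - e / 2.
have cD : c * D = z - e / 2 * D by rewrite /c mulrBl divfK// gt_eqF.
have [c0|c0] := ltP c 0.
  near=> n; apply: le_trans (Y_ge0 n); rewrite mulr_le0_ge0//.
  by move: c0; rewrite /c; lra.
have F0 : 0 < 2 + c * kappa by rewrite ltr_wpDr// mulr_ge0// ltW.
pose e' := Num.min (e / 4) (e / 2 * D / (2 + c * kappa)).
have e'0 : 0 < e' by rewrite lt_min !(divr_gt0, mulr_gt0).
have e'4 : e' <= e / 4 by rewrite ge_min lexx.
have e'F : e' * (2 + c * kappa) <= e / 2 * D by rewrite -ler_pdivlMr// ge_min lexx orbT.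
pose U n := Y n - M n.
have [n0 _ H] : \forall n \near \oo, (2 <= n)%N /\ (U n <= c * n%:R -> c <= q n).
  near=> n; have n2 : (2 <= n)%N by near: n; exact: nbhs_infty_ge.
  split=> // Un.
  have hZ : (z - e') * n%:R <= Z n by near: n; exact: Zz.
  have hS : S n <= (b + e') * n%:R by near: n; exact: Sb.
  have hM : M n <= (0 + e') * n%:R by near: n; exact: M_le.
  rewrite -(ler_pM2r (mulr_gt0 kappa_gt0 (S_gt0 _ n2))) qE//.
  have h1 := ler_wpM2l (mulr_ge0 c0 (ltW kappa_gt0)) hS.
  have h2 := ler_wpM2r (ler0n R n) e'F.
  have h3 : c * D * n%:R = (z - e / 2 * D) * n%:R by rewrite cD.
  by move: Un h1 h2 h3; rewrite /U /D; lra.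
(* Above the line only [q >= 0] is known, so one step loses at most [c] against the line. *)
pose K := Num.max c (c * n0%:R - U n0).
have Kc : c <= K by rewrite le_max lexx.
have UK j : c * (j + n0)%:R - K <= U (j + n0)%N.
  elim: j => [|j IH]; first by rewrite add0n lerBlDl -lerBlDr le_max lexx orbT.
  have [n2 Hq] := H _ (leq_addl j n0).
  have -> : U (j.+1 + n0)%N = U (j + n0)%N + q (j + n0)%N.
    by rewrite /U addSn YE//; ring.
  rewrite addSn -natr1 mulrDr mulr1.
  have [cU|/ltW cU] := leP (U (j + n0)%N) (c * (j + n0)%:R).
    by have := Hq cU; lra.
  by have /andP[] := q01 _ n2; lra.
near=> n.
have n0n : (n0 <= n)%N by near: n; exact: nbhs_infty_ge.
have := UK (n - n0)%N; rewrite subnK//.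
have hM : (0 - e') * n%:R <= M n by near: n; exact: M_ge.
have hK : K / (e / 4) <= n%:R by near: n; exact: nbhs_infty_ger.
move: hK; rewrite ler_pdivrMr ?divr_gt0// => hK.
have := ler_wpM2r (ler0n R n) e'4.
by rewrite /U /c; lra.
Unshelve. all: by end_near. Qed.

End feedback.

(** * Fluid limit of the degree counts *)

Section fluid_limit.
Context {R : realType} {lambda : R}.
Hypothesis lambda_gt0 : 0 < lambda.
Hypothesis lambdaE : (\sum_(1 <= n <oo)
  (\prod_(1 <= i < n.+1) (1 / (1 + i%:R * lambda)))%:E = 1 :> \bar R)%E.
(* [Y k n] is the number of vertices of degree at least [k] in [G_n], [S n] is
   the sum of the inverse degrees [1 / d], and [B K n] that of the
   [1 / minn d (K + 1)]. *)
Variables (Y q M B : nat -> nat -> R) (S : nat -> R).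
Hypothesis Y_ge0 : forall k n, 0 <= Y k n.
Hypothesis Y1 : forall n, (2 <= n)%N -> Y 1 n = n%:R.
Hypothesis YE : forall k n, (1 <= k)%N -> (2 <= n)%N ->
  Y k.+1 n.+1 = Y k.+1 n + q k n + (M k n.+1 - M k n).
Hypothesis qE : forall k n, (1 <= k)%N -> (2 <= n)%N ->
  q k n * (k%:R * S n) = Y k n - Y k.+1 n.
Hypothesis q01 : forall k n, (1 <= k)%N -> (2 <= n)%N -> 0 <= q k n <= 1.
Hypothesis M_le : forall k, (1 <= k)%N -> ev_le (M k) 0.
Hypothesis M_ge : forall k, (1 <= k)%N -> ev_ge (M k) 0.
Hypothesis S_ge : forall n, (2 <= n)%N -> n%:R / 2 <= S n.
Hypothesis B0 : forall n, (2 <= n)%N -> B 0 n = n%:R.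
Hypothesis BS : forall K n, (2 <= n)%N ->
  B K.+1 n = B K n - Y K.+2 n * (K.+1%:R^-1 - K.+2%:R^-1).
Hypothesis S_le_B : forall K n, (2 <= n)%N -> S n <= B K n.
Hypothesis B_le_S : forall K n, (2 <= n)%N -> B K n <= S n + n%:R / K.+1%:R.

Let S_gt0 n : (2 <= n)%N -> 0 < S n.
Proof. by move=> n2; apply: lt_le_trans (S_ge _ n2); rewrite divr_gt0// ltr0n ltnW. Qed.

Let near2 (P : nat -> Prop) : (forall n, (2 <= n)%N -> P n) -> \forall n \near \oo, P n.
Proof. by move=> h; exists 2%N => // n /= /h. Qed.

(** Each class feeds the next: the feedback bound with [kappa = k + 1] contributes the next factor
    of [surv]. *)
Let Y_ub (a : R) (k : nat) : 0 < a -> ev_ge S a -> ev_le (Y k.+1) (surv a k.+1).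
Proof.
move=> a0 Sa; elim: k => [|k IH].
  by rewrite surv1; apply: ev_le_near (ev_le_cst 1) => //; apply: near2 => n n2; rewrite mul1r Y1.
rewrite survS.
apply: (feedback_ub (Y k.+2) (Y k.+1) S (q k.+1) (M k.+1)) => //.
- by move=> n n2; exact: YE.
- by move=> n n2; exact: qE.
- by move=> n n2; exact: q01.
- exact: M_le.
- exact: M_ge.
- exact/ltW/surv_gt0/ltW.
Qed.

Let Y_lb (b : R) (k : nat) : 0 < b -> ev_le S b -> ev_ge (Y k.+1) (surv b k.+1).
Proof.
move=> b0 Sb; elim: k => [|k IH].
  by rewrite surv1; apply: ev_ge_near (ev_ge_cst 1) => //; apply: near2 => n n2; rewrite mul1r Y1.
rewrite survS.
apply: (feedback_lb (Y k.+2) (Y k.+1) S (q k.+1) (M k.+1)) => //.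
- by move=> n n2; exact: YE.
- by move=> n n2; exact: qE.
- by move=> n n2; exact: q01.
- exact: M_le.
- exact: M_ge.
- exact/ltW/surv_gt0/ltW.
Qed.

(* The limit of [B K n / n] when [S n / n] tends to [s]. *)
Let beta (s : R) (K : nat) : R := s * rho s K + surv s K.+1 / K.+1%:R.

(** Matches the recursion [BS] with [surv] in place of [Y], so that bounds on [B] follow by
    induction on [K]. *)
Let betaS (s : R) (K : nat) : 0 <= s ->
  beta s K.+1 = beta s K - surv s K.+2 * (K.+1%:R^-1 - K.+2%:R^-1).
Proof.
move=> s0; rewrite /beta /rho (big_nat_recr K.+1)//=.
have := surv_sub s K.+1 s0.
move=> /eqP; rewrite subr_eq => /eqP ->.
have : K.+1%:R != 0 :> R by rewrite pnatr_eq0.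
have : K.+2%:R != 0 :> R by rewrite pnatr_eq0.
move: K.+1%:R K.+2%:R => x y x0 y0.
by field; rewrite x0 y0.
Qed.

Let gap01 (K : nat) : 0 <= (K.+1%:R^-1 - K.+2%:R^-1 : R) <= 1.
Proof.
have h : (1 <= K.+1%:R :> R) by rewrite ler1n.
apply/andP; split.
  by rewrite subr_ge0 lef_pV2 ?posrE ?ltr0n// ler_nat.
apply: (@le_trans _ _ K.+1%:R^-1); first by rewrite gerBl invr_ge0.
by rewrite invf_le1// ltr0n.
Qed.

(** [Y] enters [BS] with a negative sign, so its upper bounds give lower bounds on [B]. *)
Let B_lb (a : R) (K : nat) : 0 < a -> ev_ge S a -> ev_ge (B K) (beta a K).
Proof.
move=> a0 Sa; elim: K => [|K IH].
  rewrite /beta /rho big_geq// surv1 mulr0 add0r divr1.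
  by apply: ev_ge_near (ev_ge_cst 1) => //; apply: near2 => n n2; rewrite mul1r B0.
rewrite betaS ?ltW//; apply: ev_ge_near (ev_geB _ _ _ _ _ (gap01 K) IH (Y_ub a K.+1 a0 Sa)) => //.
by apply: near2 => n n2; rewrite BS.
Qed.

Let B_ub (b : R) (K : nat) : 0 < b -> ev_le S b -> ev_le (B K) (beta b K).
Proof.
move=> b0 Sb; elim: K => [|K IH].
  rewrite /beta /rho big_geq// surv1 mulr0 add0r divr1.
  by apply: ev_le_near (ev_le_cst 1) => //; apply: near2 => n n2; rewrite mul1r B0.
rewrite betaS ?ltW//; apply: ev_le_near (ev_leB _ _ _ _ _ (gap01 K) IH (Y_lb b K.+1 b0 Sb)) => //.
by apply: near2 => n n2; rewrite BS.
Qed.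

(** One round of improvement of a lower bound; [1 / (K + 1)] is the cost of capping the degrees. *)
Let S_lb (a : R) (K : nat) : 0 < a -> ev_ge S a ->
  ev_ge S (a * rho a K - K.+1%:R^-1).
Proof.
move=> a0 Sa.
have K01 : 0 <= (K.+1%:R^-1 : R) <= 1.
  by rewrite invr_ge0 ler0n invf_le1 ?ltr0n// ler1n.
apply: ev_ge_near (ev_geB _ _ _ _ _ K01 (B_lb a K a0 Sa) (ev_le_cst 1)).
  rewrite mul1r lerD2r /beta lerDl divr_ge0//.
  exact/ltW/surv_gt0/ltW.
by apply: near2 => n n2; rewrite mul1r lerBlDr B_le_S.
Qed.

Let S_ub (b : R) (K : nat) : 0 < b -> ev_le S b ->
  ev_le S (b * rho b K + K.+1%:R^-1).
Proof.
move=> b0 Sb; apply: ev_le_near (B_ub b K b0 Sb).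
  by rewrite /beta lerD2l ler_piMl// ?invr_ge0// surv_le1// ltW.
by apply: near2 => n n2; exact: S_le_B.
Qed.

Let S_half : ev_ge S (1 / 2).
Proof.
apply: ev_ge_near (ev_ge_cst (1 / 2)) => //.
by apply: near2 => n n2; rewrite mulrC mulrA mulr1 S_ge.
Qed.

Let S_one : ev_le S 1.
Proof.
apply: ev_le_near (ev_le_cst 1) => //.
by apply: near2 => n n2; rewrite mul1r -(B0 n)// S_le_B.
Qed.

Let rho_near1 (e : R) : 0 < e -> \forall K \near \oo, 1 - e <= rho lambda K.
Proof.
move=> e0; have /cvgrPdist_le/(_ _ e0) := rho_cvg lambda_gt0 lambdaE.
apply: filterS => K; rewrite ler_distl => /andP[_].
by rewrite lerBlDr.
Qed.

(* Self-improvement of lower bounds: below [lambda] the map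
   [a |-> a * rho a K - 1 / (K + 1)] exceeds the identity by a fixed amount. *)
Let S_ge_lambda (a : R) : a < lambda -> ev_ge S a.
Proof.
move=> a_lt.
pose E := [set x : R | 0 < x /\ ev_ge S x].
have E2 : E (1 / 2) by split=> //; rewrite divr_gt0.
have E1 : ubound E 1 by move=> x [_ Sx]; exact: ev_ge_le Sx S_one.
have supE : has_sup E by split; [exists (1/2)|exists 1].
suff A_ge : lambda <= sup E.
  have [x [x0 Sx] ax] := sup_gt (ex_intro _ _ E2) (lt_le_trans a_lt A_ge).
  by apply: ev_ge_near Sx; [exact: ltW|exact: nearW].
rewrite leNgt; apply/negP => A_lt.
set A := sup E in A_lt.
have AE x : E x -> x <= A by move=> Ex; apply: ub_le_sup => //; exists 1.
have A2 : 1 / 2 <= A by exact: AE.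
(* The gap between [rho A] and [rho lambda] given by [rho_gap], independent of [K]. *)
pose d := 1 / (A + 1) - 1 / (lambda + 1).
have d0 : 0 < d.
  by rewrite subr_gt0 ltr_pM2l// ltf_pV2 ?posrE ?ltrD2r//; lra.
have d1 : d <= 1.
  rewrite /d lerBlDr (@le_trans _ _ 1)//.
    by rewrite ler_pdivrMr; lra.
  by rewrite lerDl divr_ge0//; lra.
(* Since [d <= 1] and [A >= 1/2], [x >= 1/4]: one round gains at least [3d/16], more than the [d/16]
   lost to [x < A] plus the [d/16] lost to capping. *)
have [x [x0 Sx] xA] : exists2 x, E x & A - d / 16 < x.
  by apply: sup_gt; [exists (1/2)|rewrite -/A; lra].
have xleA : x <= A by exact: AE.
near \oo => K.
have K1 : (0 < K)%N by near: K; exact: nbhs_infty_gt.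
have hK : 1 - d / 4 <= rho lambda K.
  by near: K; apply: rho_near1; rewrite divr_gt0.
have hK' : K.+1%:R^-1 <= d / 16.
  rewrite invf_ple ?posrE ?ltr0n// ?divr_gt0//.
  apply: (@le_trans _ _ K%:R); last by rewrite ler_nat.
  by near: K; exact: nbhs_infty_ger.
have rA : 1 + 3 * d / 4 <= rho A K.
  have A0 : 0 <= A by lra.
  have := rho_gap A lambda K.-1 A0 (ltW A_lt); rewrite prednK// -/d.
  by lra.
have rx : 1 + 3 * d / 4 <= rho x K.
  by apply: le_trans rA _; apply: rho_anti => //; exact: ltW.
have xd : 1 / 4 * d <= x * d by rewrite ler_pM2r//; lra.
have xrx := ler_wpM2l (ltW x0) rx.
have : x * rho x K - K.+1%:R^-1 <= A.
  by apply: AE; split; [move: K.+1%:R^-1 hK' => r hr; lra|exact: S_lb].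
by move: K.+1%:R^-1 hK' => r hr; lra.
Unshelve. all: by end_near. Qed.

(** The dual argument: above [lambda], the map [b |-> b * rho b K + 1 / (K + 1)] lies below the
    identity by a fixed amount for large [K], so the infimum of the valid upper bounds is at most
    [lambda]. *)
Let S_le_lambda (b : R) : lambda < b -> ev_le S b.
Proof.
move=> b_gt.
pose E := [set x : R | 0 < x /\ ev_le S x].
have E1 : E 1 by split.
have E2 : lbound E (1 / 2) by move=> x [_ Sx]; exact: ev_ge_le S_half Sx.
have infE : has_inf E by split; [exists 1|exists (1/2)].
suff A_le : inf E <= lambda.
  have [x [x0 Sx] xb] := inf_lt (ex_intro _ _ E1) (le_lt_trans A_le b_gt).
  by apply: ev_le_near Sx; [exact: ltW|exact: nearW].
rewrite leNgt; apply/negP => A_gt.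
set A := inf E in A_gt.
have AE x : E x -> A <= x by move=> Ex; apply: ge_inf => //; exists (1/2).
pose d := 1 / (lambda + 1) - 1 / (A + 1).
have d0 : 0 < d.
  by rewrite subr_gt0 ltr_pM2l// ltf_pV2 ?posrE ?ltrD2r//; have := lambda_gt0; lra.
(* As [x >= 1/2], one round lowers [x] by at least [d/2 - d/4], hence below [A]. *)
have [x [x0 Sx] xA] : exists2 x, E x & x < A + d / 4.
  by apply: inf_lt; [exists 1|rewrite -/A; lra].
have xgeA : A <= x by exact: AE.
have x2 : 1 / 2 <= x by exact: E2.
near \oo => K.
have K1 : (0 < K)%N by near: K; exact: nbhs_infty_gt.
have hK' : K.+1%:R^-1 <= d / 4.
  rewrite invf_ple ?posrE ?ltr0n// ?divr_gt0//.
  apply: (@le_trans _ _ K%:R); last by rewrite ler_nat.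
  by near: K; exact: nbhs_infty_ger.
have rA : rho A K <= 1 - d.
  have := rho_gap lambda A K.-1 (ltW lambda_gt0) (ltW A_gt); rewrite prednK// -/d.
  by have := rho_le1 lambda_gt0 lambdaE K; lra.
have rx : rho x K <= 1 - d.
  by apply: le_trans rA; apply: rho_anti => //; have := lambda_gt0; lra.
have : A <= x * rho x K + K.+1%:R^-1.
  apply: AE; split; last exact: S_ub.
  rewrite ltr_wpDl// ?invr_gt0// mulr_ge0 ?(ltW x0)//.
  by apply: sumr_ge0 => i _; exact/ltW/surv_gt0/ltW.
have xd : 1 / 2 * d <= x * d by rewrite ler_pM2r.
have := ler_wpM2l (ltW x0) rx.
by move: K.+1%:R^-1 hK' => r hr; lra.
Unshelve. all: by end_near. Qed.

(** Squeeze between [surv b k] and [surv a k] with [a < lambda < b] close to [lambda], by continuity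
    of [surv]. *)
Lemma fluid_limit (k : nat) : (1 <= k)%N ->
  (fun n => Y k n / n%:R) @ \oo --> surv lambda k.
Proof.
case: k => // k _; apply/cvgrPdist_le => e e0.
have e2 : 0 < e / 2 by rewrite divr_gt0.
have cont := surv_continuous lambda k.+1 lambda_gt0.
have /cvgrPdist_le/(_ _ e2) contl := cvg_at_left_filter cont.
have /cvgrPdist_le/(_ _ e2) contr := cvg_at_right_filter cont.
have [a [a0 al ae]] : exists a, [/\ 0 < a, a < lambda &
    surv a k.+1 <= surv lambda k.+1 + e / 2].
  near lambda^'- => a; exists a; split.
  - by near: a; exact: nbhs_left_gt.
  - by near: a; exact: nbhs_left_lt.
  have : `|surv lambda k.+1 - surv a k.+1| <= e / 2.
    by near: a; exact: contl.
  by rewrite ler_distlC => /andP[].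
have [b [lb be]] : exists b, lambda < b /\
    surv lambda k.+1 - e / 2 <= surv b k.+1.
  near lambda^'+ => b; exists b; split; first by near: b; exact: nbhs_right_gt.
  have : `|surv lambda k.+1 - surv b k.+1| <= e / 2.
    by near: b; exact: contr.
  by rewrite ler_distlC => /andP[].
have ub := Y_ub a k a0 (S_ge_lambda a al).
have lb' := Y_lb b k (lt_trans lambda_gt0 lb) (S_le_lambda b lb).
near=> n.
have n0 : 0 < n%:R :> R by rewrite ltr0n; near: n; exact: nbhs_infty_gt.
rewrite ler_distlC ler_pdivlMr// ler_pdivrMr//; apply/andP; split.
  apply: (@le_trans _ _ ((surv b k.+1 - e / 2) * n%:R)); last by near: n; exact: lb'.
  by rewrite ler_pM2r//; lra.
apply: (@le_trans _ _ ((surv a k.+1 + e / 2) * n%:R)); first by near: n; exact: ub.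
by rewrite ler_pM2r//; lra.
Unshelve. all: by end_near. Qed.

End fluid_limit.

(** * Degree statistics *)

Lemma deg_attach (g : hgraph) (i j : nat) :
  deg (attach g i) j = (deg g j + ((Defs.order g).+1 == j) + (i == j))%N.
Proof. by rewrite /deg /=; lia. Qed.

(** Invariants of the trajectory. The [n - 1] edges and the half-edge give degree sum [2n - 1],
    stated without subtraction. *)
Record reachable (n : nat) (g : hgraph) : Prop := Reachable {
  reachable_order : Defs.order g = n;
  reachable_deg_gt0 : forall j, (1 <= j <= n)%N -> (0 < deg g j)%N;
  reachable_deg_out : forall j, (n < j)%N -> deg g j = 0;
  reachable_deg_sum : (\sum_(1 <= j < n.+1) deg g j)%N.+1 = n.*2 }.

Arguments reachable_order {n g}.
Arguments reachable_deg_gt0 {n g}.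
Arguments reachable_deg_sum {n g}.

Lemma reachable_seed (i : nat) : (1 <= i <= 2)%N -> reachable 2 (seed i).
Proof.
move=> i12.
have degE j : deg (seed i) j = ((1 == j) + (2 == j) + (i == j))%N by rewrite /deg /=; lia.
split=> //.
- by move=> j j12; rewrite degE; lia.
- by move=> j j2; rewrite degE; lia.
- by rewrite 2?big_ltn// big_geq// !degE; lia.
Qed.

Lemma sum_indicator (n i : nat) : (1 <= i <= n)%N ->
  (\sum_(1 <= j < n.+1) (i == j) = 1)%N.
Proof.
move=> /andP[i1 iN].
rewrite (@big_cat_nat _ _ _ i)//=; last exact: leq_trans iN (leqnSn n).
rewrite [X in (_ + X)%N]big_ltn// eqxx !big_nat !big1//.
  by move=> j /andP[ij _]; rewrite ltn_eqF.
by move=> j /andP[_ ij]; rewrite gtn_eqF.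
Qed.

Lemma reachable_attach (n i : nat) (g : hgraph) : (1 <= i <= n)%N ->
  reachable n g -> reachable n.+1 (attach g i).
Proof.
move=> iN [gn g0 gout gsum]; split.
- by rewrite /= gn.
- move=> j jn; rewrite deg_attach gn.
  by case: (eqVneq n.+1 j) => [|nj]; [lia|have := g0 j; lia].
- by move=> j jn; rewrite deg_attach gn gout; lia.
- rewrite big_nat_recr//= deg_attach gn gout// eqxx.
  have -> : (\sum_(1 <= j < n.+1) deg (attach g i) j =
      \sum_(1 <= j < n.+1) (deg g j + (i == j)))%N.
    apply: eq_big_nat => j /andP[_ jn]; rewrite deg_attach gn.
    by rewrite (gtn_eqF jn) addn0.
  by rewrite big_split/= sum_indicator//; lia.
Qed.

Section degree_statistics.
Context {R : realType}.

Definition deg_ge (k : nat) (g : hgraph) : R :=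
  \sum_(1 <= j < (Defs.order g).+1) (k <= deg g j)%:R.

Definition inv_deg (g : hgraph) : R :=
  \sum_(1 <= j < (Defs.order g).+1) (deg g j)%:R^-1.

(** Capping degrees at [K + 1] gives a finite linear combination of the [deg_ge], within
    [1 / (K + 1)] per vertex of [inv_deg]. *)
Definition inv_min_deg (K : nat) (g : hgraph) : R :=
  \sum_(1 <= j < (Defs.order g).+1) (minn (deg g j) K.+1)%:R^-1.

Definition pick_prob (g : hgraph) (i : nat) : R :=
  attach_const R g / (deg g i)%:R.

Definition pick_deg (k : nat) (g : hgraph) : R :=
  (deg_ge k g - deg_ge k.+1 g) / (k%:R * inv_deg g).

(** The martingale increment: the indicator of picking degree [k], centred by its conditional
    mean. *)
Definition pick_dev (k : nat) (g : hgraph) (i : nat) : R :=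
  (deg g i == k)%:R - pick_deg k g.

Lemma deg_ge_ge0 (k : nat) (g : hgraph) : 0 <= deg_ge k g.
Proof. by apply: sumr_ge0. Qed.

Lemma deg_ge_sub (k : nat) (g : hgraph) : deg_ge k g - deg_ge k.+1 g =
  \sum_(1 <= j < (Defs.order g).+1) (deg g j == k)%:R.
Proof.
rewrite /deg_ge -sumrB; apply: eq_bigr => j _.
by case: ltngtP => //=; rewrite ?subrr ?subr0.
Qed.

Lemma degree_freqE (k : nat) (g : hgraph) :
  degree_freq R g k = (deg_ge k g - deg_ge k.+1 g) / (Defs.order g)%:R.
Proof.
rewrite /degree_freq deg_ge_sub -natr_sum; congr (_%:R / _).
by rewrite -sum1_count big_mkcond /= /index_iota subSS subn0; apply: eq_bigr => j _; case: eqP.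
Qed.

Section reachable.
Context {n : nat} {g : hgraph}.
Hypotheses (n2 : (2 <= n)%N) (ng : reachable n g).

Let deg_gt0 j : (1 <= j < n.+1)%N -> 0 < (deg g j)%:R :> R.
Proof. by move=> jn; rewrite ltr0n (reachable_deg_gt0 ng). Qed.

Lemma deg_ge1 : deg_ge 1 g = n%:R.
Proof.
rewrite /deg_ge (reachable_order ng) (eq_big_nat _ _ (F2 := fun=> 1)).
  by rewrite sumr_const_nat subSS subn0.
by move=> j jn; rewrite (reachable_deg_gt0 ng).
Qed.

(* [1/d >= 1 - d/4], and the degrees add up to [2n - 1]. *)
Lemma inv_deg_ge : n%:R / 2 <= inv_deg g.
Proof.
have : \sum_(1 <= j < n.+1) (1 - (deg g j)%:R / 4) <= inv_deg g.
  rewrite /inv_deg (reachable_order ng); apply: ler_sum_nat => j jn.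
  rewrite -(ler_pM2r (deg_gt0 j jn)) mulVf ?gt_eqF ?deg_gt0//.
  (* Multiplied by [d], the bound [1 - d/4 <= 1/d] is [(d - 2)^2 >= 0]. *)
  by move: (deg g j)%:R => x; have := sqr_ge0 (x - 2); rewrite expr2; lra.
apply: le_trans.
rewrite sumrB sumr_const_nat subSS subn0 -mulr_suml -natr_sum.
have : (\sum_(1 <= j < n.+1) deg g j)%N.+1%:R = n.*2%:R :> R by rewrite (reachable_deg_sum ng).
rewrite -natr1 -addnn natrD.
by move: (\sum_(1 <= j < n.+1) _)%N%:R => x; lra.
Qed.

Lemma inv_deg_gt0 : 0 < inv_deg g.
Proof. by apply: lt_le_trans inv_deg_ge; rewrite divr_gt0// ltr0n ltnW. Qed.

Lemma sum_pick_prob : \sum_(1 <= i < n.+1) pick_prob g i = 1.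
Proof.
rewrite -mulr_sumr /attach_const (reachable_order ng) mulVf// gt_eqF//.
by have := inv_deg_gt0; rewrite /inv_deg (reachable_order ng).
Qed.

Lemma pick_prob_ge0 (i : nat) : 0 <= pick_prob g i.
Proof. by rewrite divr_ge0// invr_ge0 ltW// inv_deg_gt0. Qed.

Lemma sum_pick_deg (k : nat) : (1 <= k)%N ->
  \sum_(1 <= i < n.+1) pick_prob g i * (deg g i == k)%:R = pick_deg k g.
Proof.
move=> k1; rewrite /pick_deg deg_ge_sub (reachable_order ng) mulr_suml.
apply: eq_bigr => i _; rewrite /pick_prob.
have [->|_] := eqVneq (deg g i) k; last by rewrite mulr0 mul0r.
by rewrite mulr1 mul1r invfM mulrC.
Qed.

Lemma pick_degE (k : nat) : (1 <= k)%N ->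
  pick_deg k g * (k%:R * inv_deg g) = deg_ge k g - deg_ge k.+1 g.
Proof.
by move=> k1; rewrite divfK// mulf_neq0 ?pnatr_eq0 -?lt0n// gt_eqF// inv_deg_gt0.
Qed.

Lemma pick_deg01 (k : nat) : (1 <= k)%N -> 0 <= pick_deg k g <= 1.
Proof.
move=> k1; rewrite -sum_pick_deg//; apply/andP; split.
  by apply: sumr_ge0 => i _; rewrite mulr_ge0// pick_prob_ge0.
rewrite -[leRHS]sum_pick_prob; apply: ler_sum => i _.
by rewrite ler_piMr ?pick_prob_ge0//; case: eqP.
Qed.

Lemma sum_pick_dev (k : nat) : (1 <= k)%N ->
  \sum_(1 <= i < n.+1) pick_prob g i * pick_dev k g i = 0.
Proof.
move=> k1; under eq_bigr do rewrite mulrBr.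
by rewrite sumrB sum_pick_deg// -mulr_suml sum_pick_prob mul1r subrr.
Qed.

Lemma pick_dev_le1 (k i : nat) : (1 <= k)%N -> `|pick_dev k g i| <= 1.
Proof.
move=> /pick_deg01/andP[h0 h1]; rewrite ler_norml /pick_dev.
by case: eqP => _ /=; rewrite ?mulr1n ?mulr0n; lra.
Qed.

(** The picked vertex crosses the threshold exactly when its degree was [k]; the new vertex has
    degree 1, below [k + 1]. *)
Lemma deg_ge_attach (k i : nat) : (1 <= k)%N -> (1 <= i <= n)%N ->
  deg_ge k.+1 (attach g i) = deg_ge k.+1 g + (deg g i == k)%:R.
Proof.
clear n2 => k1 iN; have [gn _ gout _] := ng.
rewrite /deg_ge /= gn big_nat_recr//= deg_attach gn gout// eqxx.
rewrite (_ : (k < _)%N = false) ?addr0; last by lia.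
rewrite (eq_big_nat _ _ (F2 := fun j => (k < deg g j)%:R +
    (deg g i == k)%:R * (i == j)%:R)); last first.
  move=> j /andP[j1 jn]; rewrite deg_attach gn (gtn_eqF jn) addn0.
  have [->|_] := eqVneq i j; last by rewrite addn0 mulr0 addr0.
  by rewrite mulr1 addn1 ltnS -natrD; congr _%:R; case: ltngtP.
rewrite big_split/= -mulr_sumr; congr (_ + _).
by rewrite -natr_sum sum_indicator// mulr1.
Qed.

Lemma inv_min_deg0 : inv_min_deg 0 g = n%:R.
Proof.
rewrite -deg_ge1 /inv_min_deg /deg_ge (reachable_order ng).
apply: eq_big_nat => j jn; have d0 := reachable_deg_gt0 ng j jn.
by rewrite d0 (minn_idPr _)// invr1.
Qed.

Lemma inv_min_degS (K : nat) : inv_min_deg K.+1 g =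
  inv_min_deg K g - deg_ge K.+2 g * (K.+1%:R^-1 - K.+2%:R^-1).
Proof.
rewrite /inv_min_deg /deg_ge mulr_suml -sumrB; apply: eq_bigr => j _.
case: (leqP K.+2 (deg g j)) => h.
  by rewrite (minn_idPr (ltnW h)) mul1r; ring.
by rewrite (minn_idPl _)// mul0r subr0.
Qed.

Lemma inv_deg_le_min (K : nat) : inv_deg g <= inv_min_deg K g.
Proof.
rewrite /inv_min_deg /inv_deg (reachable_order ng).
apply: ler_sum_nat => j jn; have d0 := reachable_deg_gt0 ng j jn.
by rewrite lef_pV2 ?posrE ?ltr0n ?leq_min ?d0// ler_nat geq_minl.
Qed.

Lemma inv_min_deg_le (K : nat) : inv_min_deg K g <= inv_deg g + n%:R / K.+1%:R.
Proof.
rewrite -deg_ge1 /inv_min_deg /inv_deg /deg_ge mulr_suml -big_split/= (reachable_order ng).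
apply: ler_sum_nat => j jn; have d0 := reachable_deg_gt0 ng j jn.
rewrite d0 mul1r; case: (leqP K.+1 (deg g j)) => h.
  by rewrite lerDr invr_ge0.
by rewrite lerDl invr_ge0.
Qed.

End reachable.
End degree_statistics.

(** * The random graph *)

HB.instance Definition _ := gen_eqMixin hgraph.
HB.instance Definition _ := gen_choiceMixin hgraph.

(** The finitely many candidates for [G (m + 2)], which turn expectations into finite sums. *)
Fixpoint graphs (m : nat) : seq hgraph :=
  if m is m'.+1 then [seq attach g i | g <- graphs m', i <- iota 1 m'.+2]
  else [:: seed 1; seed 2].

Lemma graphs_reachable (m : nat) (g : hgraph) : g \in graphs m -> reachable m.+2 g.
Proof.
elim: m g => [|m IH] g.
  by rewrite !inE => /orP[] /eqP ->; exact: reachable_seed.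
case/allpairsP => -[h i] [hm im ->].
apply: reachable_attach; last exact: IH.
by move: im; rewrite mem_iota; simpl; lia.
Qed.

Lemma attach_inj (g h : hgraph) (i j : nat) : attach g i = attach h j -> g = h.
Proof. by case: g => m es s; case: h => m' es' s' [*]; congr HGraph. Qed.

(* The list of edges, most recent first, records the whole history of the
   graph, so a sum along the trajectory is a function of the last graph. *)
Fixpoint history_sum {R : realType} (D : hgraph -> nat -> R)
    (n : nat) (es : seq (nat * nat)) (hs : seq nat) : R :=
  if es is e :: es' then
    history_sum D n.-1 es' hs + D (HGraph n.-1 es' hs) e.2
  else 0.

(** On a seed this is an artificial starting value, from its single edge; its exponential moments
    enter the constant of [dev_le]. *)
Definition cumul {R : realType} (D : hgraph -> nat -> R) (g : hgraph) : R :=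
  history_sum D (Defs.order g) (edges g) (half_edges g).

Lemma cumul_attach {R : realType} (D : hgraph -> nat -> R) (g : hgraph) (i : nat) :
  cumul D (attach g i) = cumul D g + D g i.
Proof. by case: g. Qed.

(** From [expR (- x) >= 1 - x] and [(1 - x) (1 + x + 2 x^2) = 1 + x^2 (1 - 2 x) >= 1]. *)
Lemma expR_le_quadratic {R : realType} (x : R) : x <= 1 / 2 ->
  expR x <= 1 + x + 2 * x ^+ 2.
Proof.
move=> x2; have := expR_ge1Dx (- x); rewrite expRN => h.
have x0 : 0 < 1 - x by lra.
have q0 : 0 <= 1 + x + 2 * x ^+ 2 by have := sqr_ge0 (x + 1/4); rewrite !expr2; lra.
have : (1 - x) * expR x <= 1 by rewrite -[leRHS](mulVf (lt0r_neq0 (expR_gt0 x))) ler_pM2r ?expR_gt0.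
rewrite mulrC -ler_pdivlMr// div1r => /le_trans; apply.
rewrite -div1r ler_pdivrMr// expr2.
have h2 : 0 <= 1 - 2 * x by lra.
by have := mulr_ge0 (sqr_ge0 x) h2; rewrite expr2; nra.
Qed.

Section process.
Context {d : measure_display} {T : measurableType d} {R : realType}.
Context {P : probability T R} {G : nat -> T -> hgraph}.
Hypothesis GP : inverse_depa P G.

Lemma process_graphs (m : nat) (w : T) : G m.+2 w \in graphs m.
Proof.
elim: m => [|m IH].
  by rewrite !inE; case: (depa_init GP w) => ->; rewrite eqxx ?orbT.
have [i im ->] := depa_step GP w (isT : (2 <= m.+2)%N).
by apply: allpairs_f => //; rewrite mem_iota; lia.
Qed.

Let pr (n : nat) (g : hgraph) : R := fine (P [set w | G n w = g]).

Let prE (n : nat) (g : hgraph) : (2 <= n)%N -> P [set w | G n w = g] = (pr n g)%:E.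
Proof. by move=> n2; rewrite fineK// fin_num_measure//; exact: (depa_measurable GP). Qed.

Let pr_ge0 (n : nat) (g : hgraph) : 0 <= pr n g.
Proof. by rewrite fine_ge0. Qed.

(** The new graph determines the old one, so its law is the joint probability in [depa_prob]. *)
Let pr_attach (n i : nat) (g : hgraph) : (2 <= n)%N -> (1 <= i <= n)%N ->
  pr n.+1 (attach g i) = pick_prob g i * pr n g.
Proof.
move=> n2 iN; rewrite /pr.
have -> : [set w | G n.+1 w = attach g i] =
    [set w | G n w = g /\ G n.+1 w = attach g i].
  apply/seteqP; split=> w /=; last by case.
  move=> Gg; split=> //; have [j _ Gj] := depa_step GP w n2.
  by apply: (attach_inj _ _ j i); rewrite -Gj.
by rewrite (depa_prob GP)// prE.
Qed.

(* The expectation of [F (G (m + 2))]. *)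
Let expect (m : nat) (F : hgraph -> R) : R := \sum_(g <- graphs m) pr m.+2 g * F g.

Let expectS (m : nat) (F : hgraph -> R) : expect m.+1 F =
  expect m (fun g => \sum_(1 <= i < m.+3) pick_prob g i * F (attach g i)).
Proof.
rewrite /expect -[graphs m.+1]/[seq attach g i | g <- graphs m, i <- iota 1 m.+2].
rewrite big_allpairs_dep; apply: eq_bigr => g _.
rewrite mulr_sumr /index_iota subSS subn0 !big_seq; apply: eq_bigr => i im.
rewrite pr_attach//; first by ring.
by move: im; rewrite mem_iota; lia.
Qed.

Let le_expect (m : nat) (F F' : hgraph -> R) :
  (forall g, reachable m.+2 g -> F g <= F' g) -> expect m F <= expect m F'.
Proof.
move=> FF; rewrite /expect !big_seq; apply: ler_sum => g /graphs_reachable gm.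
by rewrite ler_wpM2l// FF.
Qed.

Let expectZ (m : nat) (c : R) (F : hgraph -> R) :
  expect m (fun g => c * F g) = c * expect m F.
Proof. by rewrite /expect mulr_sumr; apply: eq_bigr => g _; ring. Qed.

(** * Concentration of martingales with bounded increments *)

Section deviation.
Variable D : hgraph -> nat -> R.
Hypothesis D0 : forall n g, (2 <= n)%N -> reachable n g ->
  \sum_(1 <= i < n.+1) pick_prob g i * D g i = 0.
Hypothesis D1 : forall n g i, (2 <= n)%N -> reachable n g -> `|D g i| <= 1.

(** One step multiplies the exponential moment by at most [1 + 2 t^2]: the linear term averages to
    zero by [D0]. *)
Let expect_exp (t : R) (m : nat) : `|t| <= 1 / 2 ->
  expect m (fun g => expR (t * cumul D g)) <=
  expect 0 (fun g => expR (t * cumul D g)) * (1 + 2 * t ^+ 2) ^+ m.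
Proof.
move=> t2; elim: m => [|m IH]; first by rewrite expr0 mulr1.
rewrite exprSr mulrA.
apply: (@le_trans _ _ (expect m (fun g => expR (t * cumul D g)) * (1 + 2 * t ^+ 2))); last first.
  by rewrite ler_wpM2r// addr_ge0// mulr_ge0// sqr_ge0.
rewrite mulrC -expectZ expectS; apply: le_expect => g gm.
have m2 : (2 <= m.+2)%N by [].
apply: (@le_trans _ _ (\sum_(1 <= i < m.+3)
    expR (t * cumul D g) * (pick_prob g i * (1 + t * D g i + 2 * t ^+ 2)))).
  apply: ler_sum => i _; rewrite cumul_attach mulrDr expRD mulrCA.
  rewrite ler_wpM2l ?expR_ge0// ler_wpM2l ?(pick_prob_ge0 m2 gm)//.
  have Di := D1 m.+2 g i m2 gm.
  have tD : `|t * D g i| <= 1 / 2.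
    by rewrite normrM -[1 / 2]mulr1 ler_pM.
  have tD' : t * D g i <= 1 / 2 by apply: le_trans tD; exact: ler_norm.
  apply: (le_trans (expR_le_quadratic _ tD')).
  rewrite lerD2l ler_wpM2l// exprMn ler_piMr ?sqr_ge0//.
  by rewrite -real_normK ?num_real// exprn_ile1.
rewrite -mulr_sumr mulrC ler_wpM2r ?expR_ge0//.
under eq_bigr do rewrite mulrDr mulrDr mulr1 mulrCA.
rewrite !big_split/= -[X in _ + X + _]mulr_sumr D0// mulr0 addr0 -mulr_suml.
by rewrite (sum_pick_prob m2 gm) mul1r.
Qed.

Let dev (e : R) (m : nat) : set T := [set w | e * m%:R <= `|cumul D (G m.+2 w)|].

(** A finite union of events [G (m + 2) = g], giving measurability and a union bound. *)
Let devE (e : R) (m : nat) : dev e m =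
  \big[setU/set0]_(g <- graphs m | e * m%:R <= `|cumul D g|) [set w | G m.+2 w = g].
Proof.
rewrite -bigcup_seq_cond; apply/seteqP; split=> w /=.
  by move=> Gw; exists (G m.+2 w) => //=; rewrite process_graphs Gw.
by case=> g /= /andP[_ gw] wg; rewrite /dev /= wg.
Qed.

Let measurable_dev (e : R) (m : nat) : measurable (dev e m).
Proof.
rewrite devE; apply: bigsetU_measurable => g _; exact: (depa_measurable GP).
Qed.

(* Markov's inequality for [exp (+- e/4 * cumul D)]. *)
Let dev_le (e : R) : 0 < e <= 1 -> exists2 C : R, 0 <= C &
  forall m, (P (dev e m) <= (C * expR (- (e ^+ 2 / 8)) ^+ m)%:E)%E.
Proof.
(* This choice minimises [- t e + 2 t^2], with value [- e^2 / 8]; [e <= 1] keeps [t] within the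
   range of [expect_exp]. *)
move=> /andP[e0 e1]; pose t := e / 4.
have t0 : 0 < t by rewrite divr_gt0.
have t2 : `|t| <= 1 / 2 by rewrite ger0_norm ?ltW// /t; lra.
have t2' : `|- t| <= 1 / 2 by rewrite normrN.
pose E s m := expect m (fun g => expR (s * cumul D g)).
have E0 s m : 0 <= E s m by apply: sumr_ge0 => g _; rewrite mulr_ge0// expR_ge0.
exists (E t 0 + E (- t) 0); first by rewrite addr_ge0.
move=> m; rewrite devE.
apply: (@le_trans _ _ (\sum_(g <- graphs m | (e * m%:R <= `|cumul D g|)%R) (pr m.+2 g)%:E)%E).
  elim: (graphs m) => [|g s IH]; first by rewrite !big_nil measure0.
  rewrite !big_cons; case: ifP => // _.
  rewrite -prE//; apply: le_trans (measureU2 _ _ _) _.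
  - exact: (depa_measurable GP).
  - by apply: bigsetU_measurable => h _; exact: (depa_measurable GP).
  - by rewrite leeD2l.
rewrite sumEFin lee_fin.
apply: (@le_trans _ _ (expR (- (t * (e * m%:R))) * (E t m + E (- t) m))).
  rewrite /E /expect -big_split/= mulr_sumr big_mkcond/=; apply: ler_sum => g _.
  rewrite -mulrDr mulrCA; case: ifPn => [gm|_]; last first.
    by rewrite !(mulr_ge0, addr_ge0, expR_ge0).
  rewrite ler_peMr// mulrDr -!expRD.
  (* The sign of [cumul D g] decides which of the two exponentials dominates. *)
  have [c0|c0] := leP 0 (cumul D g).
    rewrite -[leLHS]addr0 lerD ?expR_ge0//.
    apply: le_trans (expR_ge1Dx _); rewrite lerDl.
    move: gm; rewrite ger0_norm// => gm.
    by have := ler_wpM2l (ltW t0) gm; lra.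
  rewrite -[leLHS]add0r lerD ?expR_ge0//.
  apply: le_trans (expR_ge1Dx _); rewrite lerDl.
  move: gm; rewrite ltr0_norm// => gm.
  by have := ler_wpM2l (ltW t0) gm; lra.
apply: (@le_trans _ _ (expR (- (t * (e * m%:R))) *
    ((E t 0 + E (- t) 0) * (1 + 2 * t ^+ 2) ^+ m))).
  rewrite ler_wpM2l ?expR_ge0// mulrDl lerD ?expect_exp//.
  by rewrite -[in leRHS](sqrrN t) expect_exp.
rewrite mulrCA ler_wpM2l ?addr_ge0//.
have -> : - (t * (e * m%:R)) = (- (t * e)) * m%:R by ring.
rewrite expRM_natr -exprMn lerXn2r ?nnegrE ?mulr_ge0 ?expR_ge0//.
  by rewrite addr_ge0// mulr_ge0// sqr_ge0.
have -> : - (e ^+ 2 / 8) = - (t * e) + e ^+ 2 / 8 by rewrite /t expr2; lra.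
rewrite expRD ler_wpM2l ?expR_ge0//; apply: le_trans (expR_ge1Dx _).
by rewrite lerD2l /t !expr2; lra.
Qed.

(** Borel-Cantelli with the geometric bound of [dev_le]. *)
Let dev_null (e : R) : 0 < e <= 1 -> P (lim_sup_set (dev e)) = 0.
Proof.
move=> e01; have [C C0 hC] := dev_le e e01.
apply: lim_sup_set_cvg0 => //.
have r1 : `|expR (- (e ^+ 2 / 8))| < 1.
  rewrite ger0_norm ?expR_ge0// expR_lt1 oppr_lt0 divr_gt0// exprn_gt0//.
  by case/andP: e01.
apply: (@le_lt_trans _ _ (\sum_(0 <= m <oo) (geometric C (expR (- (e ^+ 2 / 8))) m)%:E)%E).
  by apply: lee_nneseries => m //= _; exact: hC.
rewrite (eseries_cvg _ 0 (C / (1 - expR (- (e ^+ 2 / 8)))))//; first exact: ltry.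
exact: cvg_geometric_series.
Qed.

Lemma cumul_sublinear : {ae P, forall w,
  ev_le (fun n => cumul D (G n w)) 0 /\ ev_ge (fun n => cumul D (G n w)) 0}.
Proof.
have e01 j : 0 < (j.+1%:R^-1 : R) <= 1.
  by rewrite invr_gt0 ltr0n invf_le1 ?ltr0n// ler1n.
have : {ae P, forall w, forall j, ~ lim_sup_set (dev j.+1%:R^-1) w}.
  apply: (@ae_foralln _ _ _ P (fun j w => ~ lim_sup_set (dev j.+1%:R^-1) w)) => j.
  exists (lim_sup_set (dev j.+1%:R^-1)); split.
  - by apply: bigcap_measurable => // k _; exact: bigcup_measurable.
  - exact: dev_null.
  - by move=> w /= /contrapT.
apply: filterS => w hw.
suff near_small e : 0 < e -> \forall n \near \oo, `|cumul D (G n w)| <= e * n%:R.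
  split=> e e0; have := near_small e e0; apply: filterS => n.
    by rewrite add0r; apply: le_trans; exact: ler_norm.
  by rewrite sub0r mulNr ler_norml => /andP[].
move=> e0; have [j je] : exists j, j.+1%:R^-1 <= e.
  near \oo => j; exists j; rewrite invf_ple ?posrE ?ltr0n//.
  apply: (@le_trans _ _ j%:R); last by rewrite ler_nat.
  by near: j; exact: nbhs_infty_ger.
have /existsNP[N /not_implyP[_ hN]] := hw j.
(* [dev] at index [n] concerns [G (n + 2)], with the smaller threshold [n / (j + 1)]. *)
exists N.+2 => // -[|[|n]]//= Nn.
rewrite leNgt; apply/negP => en; apply: hN; exists n => //=.
rewrite /dev /=; apply: ltW; apply: le_lt_trans en.
rewrite ler_pM// ?invr_ge0// ler_nat; lia.
Unshelve. all: by end_near. Qed.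

End deviation.

Lemma limiting_degree (lambda : R) : 0 < lambda ->
  (\sum_(1 <= n <oo)
     (\prod_(1 <= i < n.+1) (1 / (1 + i%:R * lambda)))%:E = 1 :> \bar R)%E ->
  limiting_degree_distribution P G (ptilde lambda).
Proof.
move=> lambda0 lambdaE; rewrite /limiting_degree_distribution.
have : {ae P, forall w, forall k,
   ev_le (fun n => cumul (@pick_dev R k.+1) (G n w)) 0 /\
   ev_ge (fun n => cumul (@pick_dev R k.+1) (G n w)) 0}.
  apply: (@ae_foralln _ _ _ P (fun k w =>
    ev_le (fun n => cumul (@pick_dev R k.+1) (G n w)) 0 /\
    ev_ge (fun n => cumul (@pick_dev R k.+1) (G n w)) 0)) => k.
  apply: cumul_sublinear => [n g n2 ng|n g i n2 ng].
    exact: (sum_pick_dev n2 ng).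
  exact: (pick_dev_le1 n2 ng).
apply: filterS => w M0 k k1.
have reach n : (2 <= n)%N -> reachable n (G n w).
  by case: n => [|[|n]]// _; apply: graphs_reachable; exact: process_graphs.
have lim k' : (1 <= k')%N ->
    (fun n => deg_ge k' (G n w) / n%:R) @ \oo --> surv lambda k'.
  apply: (fluid_limit lambda0 lambdaE (fun k n => deg_ge k (G n w))
    (fun k n => pick_deg k (G n w)) (fun k n => cumul (pick_dev k) (G n w))
    (fun K n => inv_min_deg K (G n w)) (fun n => inv_deg (G n w))).
  - by move=> *; exact: deg_ge_ge0.
  - by move=> n n2; exact: deg_ge1 (reach _ n2).
  (* The jump indicator is the drift [pick_deg] plus the martingale increment [pick_dev]. *)
  - move=> l n l1 n2; have [i iN ->] := depa_step GP w n2.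
    rewrite (deg_ge_attach (reach _ n2))// cumul_attach /pick_dev.
    ring.
  - by move=> l n l1 n2; exact: (pick_degE n2 (reach _ n2)).
  - by move=> l n l1 n2; exact: (pick_deg01 n2 (reach _ n2)).
  - by case=> // l _; case: (M0 l).
  - by case=> // l _; case: (M0 l).
  - by move=> n n2; exact: inv_deg_ge (reach _ n2).
  - by move=> n n2; exact: inv_min_deg0 (reach _ n2).
  - by move=> K n _; exact: inv_min_degS.
  - by move=> K n n2; exact: (inv_deg_le_min (reach _ n2)).
  - by move=> K n n2; exact: (inv_min_deg_le (reach _ n2)).
rewrite ptildeE ?ltW//.
apply: cvg_trans (cvgB (lim k k1) (lim k.+1 isT)).
apply: near_eq_cvg; near=> n.
have n2 : (2 <= n)%N by near: n; exact: nbhs_infty_ge.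
by rewrite degree_freqE (reachable_order (reach _ n2)) /= mulrBl.
Unshelve. all: by end_near. Qed.

End process.

Theorem corollary2p9 (R : realType) (lambda : R)
  (lambda_gt0 : 0 < lambda)
  (lambdaE : (\sum_(1 <= n <oo)
     (\prod_(1 <= i < n.+1) (1 / (1 + i%:R * lambda)))%:E = 1 :> \bar R)%E) :
  (forall (d : measure_display) (T : measurableType d) (P : probability T R)
      (G : nat -> T -> hgraph),
    inverse_depa P G -> limiting_degree_distribution P G (ptilde lambda)) /\
  (forall k, (1 <= k)%N -> 0 <= ptilde lambda k) /\
  (\sum_(1 <= k <oo) (ptilde lambda k)%:E = 1 :> \bar R)%E /\
  (\sum_(1 <= k <oo) (k%:R * ptilde lambda k)%:E = 2%:E :> \bar R)%E /\
  (forall k, (1 <= k)%N -> ptilde lambda k <= ptilde lambda 1) /\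
  (forall c : R, 0 < c ->
    (fun n => (expR (c * n%:R))%:E *
       \sum_(n <= k <oo) (ptilde lambda k)%:E)%E @ \oo --> 0%E).
Proof.
split; first by move=> d T P G GP; exact: limiting_degree.
split; first by move=> k _; exact: ptilde_ge0.
split; first by rewrite (ptilde_tail lambda_gt0 lambdaE) surv1.
split; first exact: ptilde_mean.
split; first by move=> k; exact: (ptilde_mode lambda_gt0 lambdaE).
by move=> c _; exact: ptilde_tail_superexp.
Qed.
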